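(* Fix an integer $k\ge1$ and a totally ordered alphabet $\mathcal A$, and let $x\in\mathcal A^n$. Run the RSK (row-insertion) algorithm on $x$. During the algorithm, some letters are bumped out of the $k$th row and inserted into the $(k+1)$th row; let $x^{(k)}$ be the string of these letters in the order in which they are bumped. Let $\bar x$ be the subsequence of $x$ consisting of those same letter occurrences, in the order they appear in $x$. Then $\mathrm{shRSK}(\bar x)\trianglerighteq\mathrm{shRSK}(x^{(k)})$.
   Context: $\mathrm{shRSK}(y)$ is the common shape (a Young diagram, i.e. partition of the length of $y$) of the tableaux produced by RSK on $y$; equivalently its first $j$ rows sum to the maximum total length of a union of $j$ disjoint weakly increasing subsequences of $y$. For partitions $\lambda,\mu$ of the same integer, $\lambda\trianglerighteq\mu$ (dominance/majorization) means $\lambda_1+\cdots+\lambda_j\ge\mu_1+\cdots+\mu_j$ for every $j$. *)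

(* Defs.v *)
From mathcomp Require Import all_boot all_order.
Set Implicit Arguments. Unset Strict Implicit. Unset Printing Implicit Defensive.
Import Order.TTheory.
Local Open Scope order_scope.

Section RSK.
Variables (d : Order.disp_t) (T : orderType d).

(* Letter occurrences are tagged with their position in the input word;
   comparisons only use the letter (first component). *)
Definition occ := (T * nat)%type.
Definition row := seq occ.

Fixpoint row_ins (a : occ) (r : row) : row * option occ :=
  match r with
  | [::] => ([:: a], None)
  | b :: r' => if a.1 < b.1 then (a :: r', Some b)
               else let: (r2, o) := row_ins a r' in (b :: r2, o)
  end.

(* Insert into a tableau (list of rows, top row first). Also returns the
   bump events (j, b): occurrence b was bumped out of row j (0-indexed)
   and inserted into row j+1, in chronological order. *)
Fixpoint tab_ins (a : occ) (t : seq row) : seq row * seq (nat * occ) :=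
  match t with
  | [::] => ([:: [:: a]], [::])
  | r :: t' =>
      match row_ins a r with
      | (r', None) => (r' :: t', [::])
      | (r', Some b) =>
          let: (t2, ev) := tab_ins b t' in
          (r' :: t2, (0%N, b) :: [seq (p.1.+1, p.2) | p <- ev])
      end
  end.

Fixpoint rsk_aux (t : seq row) (w : seq occ) : seq row * seq (nat * occ) :=
  match w with
  | [::] => (t, [::])
  | a :: w' =>
      let: (t1, ev1) := tab_ins a t in
      let: (t2, ev2) := rsk_aux t1 w' in
      (t2, ev1 ++ ev2)
  end.

Definition tag (x : seq T) : seq occ := zip x (iota 0 (size x)).

Definition RSK_P (x : seq T) : seq row := (rsk_aux [::] (tag x)).1.
Definition shRSK (x : seq T) : seq nat := map size (RSK_P x).

Definition rsk_events (x : seq T) : seq (nat * occ) := (rsk_aux [::] (tag x)).2.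

Definition bumped_occ (k : nat) (x : seq T) : seq occ :=
  [seq p.2 | p <- rsk_events x & p.1 == k.-1].

Definition xk (k : nat) (x : seq T) : seq T := map fst (bumped_occ k x).

Definition xbar (k : nat) (x : seq T) : seq T :=
  [seq y.1 | y <- tag x & y.2 \in map snd (bumped_occ k x)].

End RSK.

Definition dominates (la mu : seq nat) : Prop :=
  sumn la = sumn mu /\ forall j : nat, (sumn (take j mu) <= sumn (take j la))%N.

(* Main.v *)
Require Import Defs.
From mathcomp Require Import all_boot all_order.
From mathcomp Require Import zify.
Set Implicit Arguments. Unset Strict Implicit. Unset Printing Implicit Defensive.
Import Order.TTheory.

(** Let [p -> q] mean that [q] comes after [p] in a word and is strictly smaller.
An [m]-step walk system is a family of walks of length [m] along this relation,
pairwise distinct at every step (but allowed to share letters at different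
steps). Knuth moves towards the reading word of the tableau preserve the maximal
size of such systems, by rerouting around the one lost inversion; undoing the
moves even preserves the set of starting points. In the reading word every step
goes to a higher row, and going up the columns is a walk system, so the maximal
size is the number of cells below row [m], and in the word itself one can start
from exactly the letters that end up below row [m].
Now take [j] steps inside [xbar], then [k] steps inside [x] starting from the
letters of [xbar], which are those ending up below row [k]: the number of cells
of [shRSK xbar] below row [j] is at most the number of cells of [shRSK x] below
row [j + k]. Since [shRSK (xk k x)] is [shRSK x] without its first [k] rows, this
is the dominance claimed. *)

Section Walks.
Variables (d : Order.disp_t) (T : orderType d).
Implicit Types (a b c p q x y z : occ T) (w l r A B : seq (occ T)).

(** * Inversions and walk systems *)

Definition inv w p q :=
  [&& (q.1 < p.1)%O, index p w < index q w & q \in w].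

Lemma inv_meml w p q : inv w p q -> p \in w.
Proof. by case/and3P=> _ pq; rewrite -!index_mem; apply: ltn_trans. Qed.

Lemma inv_memr w p q : inv w p q -> q \in w.
Proof. by case/and3P. Qed.

(* [A] is the set of starting points; [f] gives the first step of each walk. *)
Fixpoint walks w m A : Prop :=
  if m is m'.+1 then
    exists f : occ T -> occ T,
      [/\ {in A &, injective f}, {in A, forall p, inv w p (f p)}
        & walks w m' (map f A)]
  else True.

Lemma walks_sub w m A B : {subset B <= A} -> walks w m A -> walks w m B.
Proof.
elim: m A B => //= m IH A B sBA [f [injf invf walkf]]; exists f; split.
- by move=> p q /sBA Ap /sBA Aq; apply: injf.
- by move=> p /sBA; apply: invf.
- by apply: IH walkf => _ /mapP[p /sBA Ap ->]; apply: map_f.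
Qed.

(** Steps inside [w'] end at letters of [w'], so after [j] of them any walk system starting from all
    of [w'] can take over. *)
Lemma walks_cat w w' j k A :
    (forall p q, inv w' p q -> inv w p q) ->
    {subset A <= w'} -> walks w' j A -> walks w k w' ->
  walks w (j + k) A.
Proof.
move=> sub; elim: j A => [|j IH] A sA /= wA wk; first exact: walks_sub wk.
case: wA => f [injf invf walkf]; exists f; split=> //.
  by move=> p Ap; apply/sub/invf.
by apply: IH => // _ /mapP[p Ap ->]; apply: inv_memr (invf p Ap).
Qed.

Lemma sub_walks w w' m A :
  (forall p q, inv w p q -> inv w' p q) -> walks w m A -> walks w' m A.
Proof.
move=> sub; elim: m A => //= m IH A [f [injf invf walkf]].
by exists f; split=> // [p Ap|]; [apply/sub/invf | apply: IH].
Qed.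

(** * Rerouting walks *)

Definition swap x y p := if p == x then y else if p == y then x else p.

Lemma swapK x y : involutive (swap x y).
Proof.
move=> p; rewrite /swap; case: (eqVneq p x) => [->|px].
  by case: (eqVneq y x) => [->|_]; rewrite ?eqxx.
by case: (eqVneq p y) => [->|py]; rewrite ?eqxx // (negPf px) (negPf py).
Qed.

Lemma swap_inj x y : injective (swap x y).
Proof. exact: inv_inj (swapK x y). Qed.

Lemma mem_map_swap x y A : x \in A -> y \in A -> A =i map (swap x y) A.
Proof.
move=> Ax Ay p; apply/idP/mapP => [Ap|[q Aq ->]].
  exists (swap x y p); last by rewrite swapK.
  by rewrite /swap; case: eqP => // _; case: eqP.
by rewrite /swap; case: eqP => // _; case: eqP.
Qed.

(** If [y] is already a start, the swapped set is [A] itself; otherwise [y] takes over the first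
    step of [x], which [dom] makes available. *)
Lemma walks_swap_start w m A x y :
    (forall q, inv w x q -> inv w y q) ->
  x \in A -> walks w m A -> walks w m (map (swap x y) A).
Proof.
move=> dom Ax wA; have [Ay|nAy] := boolP (y \in A).
  by apply: walks_sub wA => p; rewrite -(mem_map_swap Ax Ay).
case: m wA => //= m [f [injf invf walkf]].
have fK : map (f \o swap x y) (map (swap x y) A) = map f A.
  by rewrite -map_comp; apply: eq_map => p /=; rewrite swapK.
exists (f \o swap x y); split; last by rewrite fK.
- move=> _ _ /mapP[p Ap ->] /mapP[q Aq ->] /=; rewrite !swapK.
  by move/(injf _ _ Ap Aq) ->.
- move=> _ /mapP[p Ap ->] /=; rewrite swapK; have:= invf p Ap.
  rewrite /swap; case: (eqVneq p x) => [->|px]; first exact: dom.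
  by case: (eqVneq p y) => [py|//]; rewrite -py Ap in nAy.
Qed.

Lemma inv_transpose l r a b p q :
    (p, q) != (a, b) -> inv (l ++ a :: b :: r) p q ->
  inv (l ++ b :: a :: r) p q.
Proof.
rewrite xpair_eqE => npq /and3P[lt_qp ltpq qw]; apply/and3P; split => //.
  move: ltpq npq; rewrite !index_cat /=.
  rewrite (eq_sym a p) (eq_sym b p) (eq_sym a q) (eq_sym b q).
  have := index_mem p l; have := index_mem q l.
  by case: (p \in l); case: (q \in l); case: (p == a); case: (p == b);
    case: (q == a); case: (q == b) => //=; lia.
by move: qw; rewrite !mem_cat !inE; case/or4P=> ->; rewrite ?orbT.
Qed.

Lemma inv_consE a w p q : a \notin w ->
  inv (a :: w) p q =
  if p == a then (q.1 < p.1)%O && (q \in w) else (q != a) && inv w p q.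
Proof.
rewrite /inv /= inE (eq_sym a p) (eq_sym a q) => aw.
case: (eqVneq p a) => [->|pa]; case: (eqVneq q a) => [->|qa] //=.
- by rewrite (negPf aw) ltxx.
- by rewrite andbF.
Qed.

Lemma inv_cat_in l w p q : p \in l -> q \notin l ->
  inv (l ++ w) p q = (q.1 < p.1)%O && (q \in w).
Proof.
move=> pl /negPf ql; rewrite /inv !index_cat pl mem_cat ql /=.
by rewrite (leq_trans _ (leq_addr _ _)) ?index_mem.
Qed.

Lemma inv_cat_notin l w p q : p \notin l ->
  inv (l ++ w) p q = (q \notin l) && inv w p q.
Proof.
move=> /negPf pl; rewrite /inv !index_cat pl mem_cat.
case: ifP => [ql|_]; last by rewrite ltn_add2l.
by rewrite (leq_gtF (leq_trans (index_size _ _) (leq_addr _ _))) andbF.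
Qed.

(** * Knuth moves and their effect on walk systems *)

(** The moves are directed, as row insertion performs them: the first kind loses the inversion from
    [z] to [x], the second gains it. Ties count as increasing from left to right. *)
Inductive knuth w : seq (occ T) -> Prop :=
| knuth_refl : knuth w w
| knuth_yzx l r x y z : (x.1 < y.1)%O -> (y.1 <= z.1)%O ->
    knuth w (l ++ [:: y; z; x] ++ r) -> knuth w (l ++ [:: y; x; z] ++ r)
| knuth_xzy l r x y z : (x.1 <= y.1)%O -> (y.1 < z.1)%O ->
    knuth w (l ++ [:: x; z; y] ++ r) -> knuth w (l ++ [:: z; x; y] ++ r).

Lemma knuth_trans w1 w2 w3 : knuth w1 w2 -> knuth w2 w3 -> knuth w1 w3.
Proof.
move=> k12; elim=> {w3} [|l r x y z xy yz _|l r x y z xy yz _] //.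
  exact: knuth_yzx.
exact: knuth_xzy.
Qed.

Lemma knuth_cat l r w1 w2 : knuth w1 w2 -> knuth (l ++ w1 ++ r) (l ++ w2 ++ r).
Proof.
elim=> {w2} [|l' r' x y z xy yz _ IH|l' r' x y z xy yz _ IH].
- exact: knuth_refl.
- move: IH; rewrite -!catA !(catA l l') => IH.
  exact: (knuth_yzx xy yz).
- move: IH; rewrite -!catA !(catA l l') => IH.
  exact: (knuth_xzy xy yz).
Qed.

Lemma knuth_perm w w' : knuth w w' -> perm_eq w w'.
Proof.
elim=> {w'} [|l r x y z _ _ _|l r x y z _ _ _] //.
  by move/perm_trans; apply; rewrite perm_cat2l /= perm_cons (perm_catCA [:: z] [:: x]).
by move/perm_trans; apply; rewrite perm_cat2l (perm_catCA [:: x] [:: z]).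
Qed.

(* Only targets of steps are rerouted, so the set of starts is unchanged. *)
Lemma walks_xzy l r x y z m A :
    uniq (l ++ [:: x; z; y] ++ r) -> (x.1 <= y.1)%O -> (y.1 < z.1)%O ->
  walks (l ++ [:: z; x; y] ++ r) m A -> walks (l ++ [:: x; z; y] ++ r) m A.
Proof.
move=> uw xy yz.
have xz : (x.1 < z.1)%O by apply: le_lt_trans yz.
have [nlx nlz nly /and4P[nx nz ny _]] : [/\ x \notin l, z \notin l, y \notin l
   & uniq [:: x, z, y & r]].
  move: uw; rewrite cat_uniq => /and3P[_ /= hl ->].
  by move: hl; rewrite !negb_or => /and4P[].
have [xNz xNy] : x != z /\ x != y.
  by move: nx; rewrite !inE !negb_or => /and3P[].
have zNy : z != y by move: nz; rewrite inE negb_or => /andP[].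
have nx' : x \notin y :: r by apply: contra nx; rewrite !inE => ->; rewrite orbT.
have nz' : z \notin x :: y :: r by rewrite inE negb_or eq_sym xNz.
set w := l ++ [:: x; z; y] ++ r; set w' := l ++ [:: z; x; y] ++ r.
have F1 p q : (p, q) != (z, x) -> inv w' p q -> inv w p q.
  exact: inv_transpose.
have F2 : inv w z y.
  rewrite inv_cat_notin // nly inv_consE // inv_consE //.
  by rewrite [z == x]eq_sym (negPf xNz) eqxx yz !inE eqxx [y == x]eq_sym xNy.
have F3 p : p != z -> inv w' p y -> inv w p x.
  move=> pz; have [pl|pl] := boolP (p \in l).
    rewrite !inv_cat_in // => /andP[yp _].
    by rewrite (le_lt_trans xy yp) !inE eqxx.
  rewrite inv_cat_notin // nly inv_consE // (negPf pz) inv_consE //.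
  rewrite inv_consE // eqxx; case: (eqVneq p x) => [->|_].
    by rewrite ltNge xy andbF.
  by case: (eqVneq p y) => [->|_]; rewrite ?ltxx !andbF.
(* The letters [z] and [y] are not below [x], so a step from [x] lands in [r], which also comes
   after [y]. *)
have F4 q : inv w x q -> inv w y q.
  rewrite (inv_cat_notin _ _ nlx) (inv_cat_notin _ _ nly) => /andP[->].
  rewrite !inv_consE // !eqxx.
  rewrite [y == x]eq_sym (negPf xNy) [y == z]eq_sym (negPf zNy).
  case/andP=> qx; rewrite !inE (lt_le_trans qx xy) /=.
  case: eqP qx => [->|_ qx]; first by rewrite ltNge (ltW xz).
  case: eqP qx => [->|_ qx]; first by rewrite ltNge xy.
  by case: eqP qx => [->|//]; rewrite ltxx.
elim: m A => //= m IH A [f [injf invf walkf]].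
have [/andP[Az /eqP fz]|nzx] := boolP ((z \in A) && (f z == x)); last first.
  exists f; split=> // [p Ap|]; last exact: IH.
  apply: F1 (invf p Ap); apply: contra nzx => /eqP[<- ->].
  by rewrite Ap eqxx.
(* The missing step from [z] to [x] is sent to [y], and a walk that stepped to [y] is sent to [x].
   The continuations can be exchanged because [y] has every step of [x] ([F4]). *)
exists (swap x y \o f); split.
- by move=> p q Ap Aq /swap_inj; apply: injf.
- move=> p Ap /=; rewrite /swap; case: (eqVneq (f p) x) => [fp|fpx].
    by rewrite (injf p z) // fz.
  have pz : p != z by apply: contraNneq fpx => ->; apply/eqP.
  have := invf p Ap; case: (eqVneq (f p) y) => [->|_]; first exact: F3.
  by apply: F1; apply: contra pz => /eqP[->].
- rewrite map_comp; apply: walks_swap_start => //; last exact: IH.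
  by rewrite -fz map_f.
Qed.

(* Here the sources of steps are rerouted, which may replace a start [z] by [y]. *)
Lemma walks_yzx l r x y z m A :
    uniq (l ++ [:: y; z; x] ++ r) -> (x.1 < y.1)%O -> (y.1 <= z.1)%O ->
    walks (l ++ [:: y; z; x] ++ r) m A ->
  walks (l ++ [:: y; x; z] ++ r) m A \/
  [/\ z \in A, y \notin A
    & walks (l ++ [:: y; x; z] ++ r) m (map (swap y z) A)].
Proof.
move=> uw xy yz.
have xz : (x.1 < z.1)%O by apply: lt_le_trans yz.
have [nly nlz nlx /and4P[ny nz nx _]] : [/\ y \notin l, z \notin l, x \notin l
   & uniq [:: y, z, x & r]].
  move: uw; rewrite cat_uniq => /and3P[_ /= hl ->].
  by move: hl; rewrite !negb_or => /and4P[].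
have [yNz yNx] : y != z /\ y != x.
  by move: ny; rewrite !inE !negb_or => /and3P[].
have zNx : z != x by move: nz; rewrite inE negb_or => /andP[].
have ny' : y \notin [:: x, z & r] by apply: contra ny; rewrite !inE orbCA.
have nx' : x \notin z :: r by rewrite inE negb_or eq_sym zNx.
have nz' : z \notin r by apply: contra nz; rewrite inE => ->; rewrite orbT.
set w := l ++ [:: y; z; x] ++ r; set w' := l ++ [:: y; x; z] ++ r.
have G1 p q : (p, q) != (z, x) -> inv w p q -> inv w' p q.
  have -> : w = (l ++ [:: y]) ++ [:: z, x & r] by rewrite -catA.
  have -> : w' = (l ++ [:: y]) ++ [:: x, z & r] by rewrite -catA.
  exact: inv_transpose.
have G2 p : inv w p z -> inv w p y.
  have [pl|pl] := boolP (p \in l).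
    rewrite !inv_cat_in // => /andP[zp _].
    by rewrite (le_lt_trans yz zp) !inE eqxx.
  rewrite inv_cat_notin // nlz inv_consE // inv_consE // eqxx.
  case: (eqVneq p y) => [->|_]; first by rewrite ltNge yz andbF.
  by case: (eqVneq p z) => [->|_]; rewrite ?ltxx !andbF.
have G3 : inv w' y x by rewrite inv_cat_notin // nlx inv_consE // eqxx xy !inE eqxx.
have G4 q : q != x -> inv w y q -> inv w' z q.
  move=> qx; rewrite (inv_cat_notin _ _ nly) (inv_cat_notin _ _ nlz) => /andP[->].
  rewrite !inv_consE // !eqxx.
  rewrite [z == y]eq_sym (negPf yNz) (negPf zNx) qx.
  case/andP=> qy; rewrite !inE (lt_le_trans qy yz) (negPf qx) /=.
  case: eqP qy => [->|_ qy]; first by rewrite ltNge yz.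
  by case: eqP qy => [->|//]; rewrite ltxx.
elim: m A => [|m IH] A /=; first by left.
case=> f [injf invf walkf].
(* The induction hypothesis may move the start of a continuation from [z] to [y]; the walk that
   stepped to [z] then steps to [y] instead, by [G2]. *)
have [f0 [injf0 invf0 walkf0]] : exists f0, [/\ {in A &, injective f0},
    {in A, forall p, inv w p (f0 p)} & walks w' m (map f0 A)].
  case: (IH _ walkf) => [wf|[zB yB wf]]; first by exists f.
  exists (swap y z \o f); split; last by rewrite map_comp.
  - by move=> p q Ap Aq /swap_inj; apply: injf.
  - move=> p Ap /=; have := invf p Ap; rewrite /swap.
    case: eqP => [fp|_]; first by rewrite -fp map_f in yB.
    by case: eqP => [->|//]; apply: G2.
have [/andP[Az /eqP fz]|nzx] := boolP ((z \in A) && (f0 z == x)); last first.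
  left; exists f0; split=> // p Ap.
  apply: G1 (invf0 p Ap); apply: contra nzx => /eqP[<- ->].
  by rewrite Ap eqxx.
(* The step to [x] is now made from [y], and a walk that started at [y] starts at [z]. By
   injectivity that walk does not step to [x], so [G4] applies. *)
have wA : walks w' m.+1 (map (swap y z) A).
  exists (f0 \o swap y z); split.
  - move=> _ _ /mapP[p Ap ->] /mapP[q Aq ->] /=; rewrite !swapK.
    by move/(injf0 _ _ Ap Aq) ->.
  - move=> _ /mapP[p Ap ->] /=; rewrite swapK; have := invf0 p Ap; rewrite /swap.
    case: (eqVneq p y) => [py|_]; first subst p.
      by apply: G4; apply: contra yNz; rewrite -fz => /eqP/(injf0 _ _ Ap Az)->.
    case: (eqVneq p z) => [->|pz]; first by rewrite fz.
    by apply: G1; apply: contra pz => /eqP[->].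
  - rewrite -map_comp (_ : map _ A = map f0 A) //.
    by apply: eq_map => p /=; rewrite swapK.
have [Ay|yA] := boolP (y \in A); last by right.
by left; apply: walks_sub wA => p; rewrite -(mem_map_swap Ay Az).
Qed.

(** Undoing a move of the first kind only adds inversions; undoing one of the second kind is handled
    by [walks_xzy]. Neither changes the starts. *)
Lemma knuth_walks w w' m A : uniq w -> knuth w w' -> walks w' m A -> walks w m A.
Proof.
move=> uw; elim=> // {w'} l r x y z xy yz kw IH /=.
  have uw' : uniq (l ++ [:: y; z; x] ++ r) by rewrite -(perm_uniq (knuth_perm kw)).
  move=> wA; apply: IH; apply: sub_walks wA => p q pq.
  have -> : l ++ [:: y; z; x] ++ r = (l ++ [:: y]) ++ [:: z, x & r] by rewrite -catA.
  apply: inv_transpose; last by rewrite -catA.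
  case: eqP pq => // -[-> ->]; case/and3P=> zx.
  by move: (lt_trans zx xy); rewrite ltNge yz.
have uw' : uniq (l ++ [:: x; z; y] ++ r) by rewrite -(perm_uniq (knuth_perm kw)).
by move=> wA; apply: IH; apply: walks_xzy wA.
Qed.

(** Going forward, a move of the first kind may replace a start, as in [walks_yzx], so only the
    number of starts is kept. *)
Lemma walks_knuth w w' m A :
    uniq w -> knuth w w' -> uniq A -> {subset A <= w} -> walks w m A ->
  exists A', [/\ size A' = size A, uniq A', {subset A' <= w'} & walks w' m A'].
Proof.
move=> uw kw uA Aw wA; elim: kw => [|l r x y z xy yz kw|l r x y z xy yz kw].
- by exists A.
- have uw' : uniq (l ++ [:: y; z; x] ++ r) by rewrite -(perm_uniq (knuth_perm kw)).
  have memw : l ++ [:: y; z; x] ++ r =i l ++ [:: y; x; z] ++ r.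
    by apply/perm_mem/knuth_perm/knuth_yzx/knuth_refl.
  case=> B [<- uB Bw wB].
  case: (walks_yzx uw' xy yz wB) => [wB'|[zB yB wB']].
    by exists B; split=> // p /Bw; rewrite memw.
  exists (map (swap y z) B); split=> //; first by rewrite size_map.
    by rewrite map_inj_uniq //; apply: swap_inj.
  move=> _ /mapP[p /Bw pw ->]; rewrite -memw /swap.
  case: eqP => _; first by rewrite !mem_cat !inE eqxx !orbT.
  by case: eqP => // _; rewrite !mem_cat !inE eqxx !orbT.
- case=> B [<- uB Bw wB]; exists B; split=> //.
    by move=> p /Bw; rewrite (perm_mem (knuth_perm (knuth_xzy xy yz (knuth_refl _)))).
  apply: sub_walks wB => p q pq.
  apply: inv_transpose (pq); case: eqP pq => // -[-> ->]; case/and3P=> zx.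
  by move: (le_lt_trans xy yz); rewrite ltNge (ltW zx).
Qed.

(** * Row insertion as a sequence of Knuth moves *)

Local Notation leo := (fun p q : occ T => (p.1 <= q.1)%O).

Lemma leo_trans : transitive leo.
Proof. by move=> q p r; apply: le_trans. Qed.

Variant row_ins_spec a r : row T * option (occ T) -> Prop :=
| RowAppend of all (leo^~ a) r : row_ins_spec a r (rcons r a, None)
| RowBump u b v of r = u ++ b :: v & all (leo^~ a) u & (a.1 < b.1)%O :
    row_ins_spec a r (u ++ a :: v, Some b).

Lemma row_insP a r : row_ins_spec a r (row_ins a r).
Proof.
elim: r => [|c r IH] /=; first by constructor.
case: ltP => [ac|ca]; first exact: (@RowBump a (c :: r) [::] c r).
case: IH => [ra|u b v -> ua ab]; first by apply: (@RowAppend a (c :: r)); rewrite /= ca.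
by apply: (@RowBump a _ (c :: u)); rewrite //= ca.
Qed.

Lemma row_ins_lt a r r' b : row_ins a r = (r', Some b) -> (a.1 < b.1)%O.
Proof. by case: row_insP => // u b' v _ _ ab [_ <-]. Qed.

Lemma sorted_row_ins a r : sorted leo r -> sorted leo (row_ins a r).1.
Proof.
case: row_insP => [ra|u b v -> ua ab] /=; rewrite !(sorted_pairwise leo_trans).
  by rewrite pairwise_rcons ra.
rewrite !pairwise_cat /= !allrel_consr ua => /and3P[/andP[_ ->] -> /andP[bv ->]].
by rewrite /= andbT; apply: sub_all bv => p; apply/le_trans/ltW.
Qed.

Lemma knuth_cons c w1 w2 : knuth w1 w2 -> knuth (c :: w1) (c :: w2).
Proof. by move/(knuth_cat [:: c] [::]); rewrite !cats0. Qed.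

(** The letter [a] moves left past [v] one letter at a time; the left neighbour of the exchanged
    pair plays [y]. *)
Lemma knuth_slide_left a b v : sorted leo (b :: v) -> (a.1 < b.1)%O ->
  knuth (b :: rcons v a) (b :: a :: v).
Proof.
elim: v b => [|c v IH] b /=; first by move=> *; apply: knuth_refl.
case/andP=> bc cv ab; have ac : (a.1 < c.1)%O by apply: lt_le_trans bc.
apply: (knuth_trans (knuth_cons b (IH c cv ac))).
exact: (@knuth_yzx _ [::] v a b c ab bc (knuth_refl _)).
Qed.

(** The letter [b] moves left past [u] one letter at a time; the right neighbour of the exchanged
    pair, in [u] or [a] itself, plays [y]. *)
Lemma knuth_slide_right a b u v : sorted leo u -> all (leo^~ a) u ->
  (a.1 < b.1)%O -> knuth (u ++ b :: a :: v) (b :: u ++ a :: v).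
Proof.
elim: u => [|c u IH] /=; first by move=> *; apply: knuth_refl.
move=> cu /andP[ca ua] ab.
apply: (knuth_trans (knuth_cons c (IH (path_sorted cu) ua ab))).
case: u cu ua {IH} => [_ _|e u /andP[ce _] /andP[ea _]] /=.
  exact: (@knuth_xzy _ [::] v c a b ca ab (knuth_refl _)).
have eb : (e.1 < b.1)%O by apply: le_lt_trans ab.
exact: (@knuth_xzy _ [::] (u ++ a :: v) c e b ce eb (knuth_refl _)).
Qed.

(** First [a] slides left to just after the letter [b] that it bumps, then [b] slides to the front,
    where it follows the lower rows in the reading word, ready to be inserted there. *)
Lemma knuth_row_ins a r : sorted leo r ->
  knuth (rcons r a)
    (if (row_ins a r).2 is Some b then b :: (row_ins a r).1
     else (row_ins a r).1).
Proof.
case: row_insP => [_ _|u b v -> ua ab] /=; first exact: knuth_refl.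
move=> suv.
have su : sorted leo u := subseq_sorted leo_trans (prefix_subseq _ _) suv.
have sv : sorted leo (b :: v) := subseq_sorted leo_trans (suffix_subseq _ _) suv.
apply: knuth_trans (knuth_slide_right v su ua ab).
rewrite rcons_cat /=; have := knuth_slide_left sv ab.
by move/(knuth_cat u [::]); rewrite !cats0.
Qed.

(** * Tableaux and their reading words *)

Fixpoint colstrict (r s : row T) {struct s} : bool :=
  match s, r with
  | [::], _ => true
  | q :: s', p :: r' => (p.1 < q.1)%O && colstrict r' s'
  | _, _ => false
  end.

Lemma colstrict_nth p0 r s i : colstrict r s -> i < size s ->
  i < size r /\ ((nth p0 r i).1 < (nth p0 s i).1)%O.
Proof.
elim: s r i => [|q s IH] [|p r] i //= /andP[pq rs].
by case: i => [|i] //=; rewrite !ltnS; apply: IH.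
Qed.

Lemma colstrict_ins_upper a r s : colstrict r s -> colstrict (row_ins a r).1 s.
Proof.
elim: r s => [|c r IH] [|q s] //=.
case/andP=> cq rs; case: ltP => [ac|_] /=.
  by rewrite (lt_trans ac cq).
by move: (IH s rs); case: (row_ins a r) => /= r' o ->; rewrite cq.
Qed.

(** The entry of [s] under [b], if any, exceeds [b], so [b] lands weakly left of its old column,
    where the entries of [r'] are at most [a], hence below [b]. *)
Lemma colstrict_bump a r s r' b :
    colstrict r s -> row_ins a r = (r', Some b) ->
  colstrict r' (row_ins b s).1.
Proof.
elim: r s r' => [|c r IH] s r' //= rs.
case: ltP => [ac [<- <-]|ca].
  by case: s rs => [|q s] /= => [_|/andP[-> rs]]; rewrite /= ac.
case E : (row_ins a r) => [r1 o] [<- eo]; rewrite eo in E.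
have ab := row_ins_lt E.
have cb := le_lt_trans ca ab.
case: s rs => [_|q s /andP[cq rs]] /=; first by rewrite cb.
case: ltP => [_|_] /=; first by rewrite cb; have := colstrict_ins_upper a rs; rewrite E.
by have := IH _ _ rs E; case: (row_ins b s) => /= ? ? ->; rewrite cq.
Qed.

Definition read (t : seq (row T)) : row T := flatten (rev t).

Lemma read_cons r t : read (r :: t) = read t ++ r.
Proof. by rewrite /read rev_cons flatten_rcons. Qed.

Lemma perm_read t : perm_eq (read t) (flatten t).
Proof. by rewrite perm_flatten // perm_rev. Qed.

Definition tableau t := all (sorted leo) t && sorted colstrict t.

Lemma tableau_behead r t : tableau (r :: t) -> tableau t.
Proof. by case/andP=> /= /andP[_ st] /path_sorted ct; apply/andP. Qed.

Lemma head_tab_ins a t :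
  head [::] (tab_ins a t).1 = (row_ins a (head [::] t)).1.
Proof.
case: t => //= r t; case: (row_ins a r) => r' [b|] //=.
by case: (tab_ins b t).
Qed.

Lemma path_colstrict r t : path colstrict r t = colstrict r (head [::] t) && sorted colstrict t.
Proof. by case: t. Qed.

Lemma tableau_ins a t : tableau t -> tableau (tab_ins a t).1.
Proof.
elim: t a => //= r t IH a rt; have := IH ^~ (tableau_behead rt).
have := head_tab_ins ^~ t.
case/andP: rt => /= /andP[sr st]; rewrite path_colstrict => /andP[crt ct].
have := sorted_row_ins a sr; have := colstrict_ins_upper a crt.
have := @colstrict_bump a r _ _ _ crt.
case: (row_ins a r) => r' [b|] /= cb cr' sr' hd IHt.
  have := hd b; have := IHt b; case: (tab_ins b t) => t2 ev /= /andP[st2 ct2] hd2.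
  by rewrite /tableau /= sr' st2 path_colstrict ct2 hd2 (cb _ b erefl).
by rewrite /tableau /= sr' st path_colstrict cr'.
Qed.

Lemma knuth_tab_ins a t : tableau t ->
  knuth (rcons (read t) a) (read (tab_ins a t).1).
Proof.
elim: t a => [|r t IH] a rt; first exact: knuth_refl.
have {}IH b := IH b (tableau_behead rt).
case/andP: rt => /= /andP[sr _] _; have := knuth_row_ins a sr.
case: (row_ins a r) => r' [b|] /=; rewrite !read_cons rcons_cat.
  move/(knuth_cat (read t) [::]); rewrite !cats0 => /knuth_trans; apply.
  have := IH b; case: (tab_ins b t) => t2 ev /=; rewrite read_cons.
  by move/(knuth_cat [::] r'); rewrite cat_rcons.
by move/(knuth_cat (read t) [::]); rewrite !cats0.
Qed.

(** * RSK on words: reading word, lower rows, independence of tags *)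

Lemma rsk_cons t a w : (rsk_aux t (a :: w)).1 = (rsk_aux (tab_ins a t).1 w).1.
Proof. by rewrite /=; case: (tab_ins a t) => t1 ev; case: (rsk_aux t1 w). Qed.

Lemma rsk_cat t w w' :
  (rsk_aux t (w ++ w')).1 = (rsk_aux (rsk_aux t w).1 w').1.
Proof. by elim: w t => // a w IH t; rewrite cat_cons !rsk_cons IH. Qed.

Lemma tableau_rsk t w : tableau t -> tableau (rsk_aux t w).1.
Proof. by elim: w t => // a w IH t tt; rewrite rsk_cons; apply/IH/tableau_ins. Qed.

Lemma knuth_rsk t w : tableau t -> knuth (read t ++ w) (read (rsk_aux t w).1).
Proof.
elim: w t => [|a w IH] t tt; first by rewrite cats0; apply: knuth_refl.
rewrite rsk_cons; apply: knuth_trans (IH _ (tableau_ins a tt)).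
by rewrite -cat_rcons; apply: (knuth_cat [::] w (knuth_tab_ins a tt)).
Qed.

Lemma perm_rsk w : perm_eq (flatten (rsk_aux [::] w).1) w.
Proof.
rewrite -(permPl (perm_read _)) perm_sym.
by apply: (@knuth_perm w); apply: (knuth_rsk w (t := [::])).
Qed.

(** An insertion reaches the rows of index above [k] only through the letter, if any, bumped out of
    row [k] (counted from 0). *)
Lemma tab_ins_drop k a t :
  drop k.+1 (tab_ins a t).1 =
  (rsk_aux (drop k.+1 t) [seq e.2 | e <- (tab_ins a t).2 & e.1 == k]).1.
Proof.
elim: t k a => [|r t IH] k a //=.
case: (row_ins a r) => r' [b|] //=; have := IH ^~ b.
case E : (tab_ins b t) => [t2 ev] /= {}IH.
have evE j : [seq e.2 | e <- [seq (e.1.+1, e.2) | e <- ev] & e.1 == j.+1] =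
             [seq e.2 | e <- ev & e.1 == j].
  by elim: (ev) => //= e ev' IHev; rewrite eqSS; case: eqP => _ /=; rewrite IHev.
case: k => [|k] /=; last by rewrite evE IH.
(* Events of the lower rows carry shifted indices, so none has index 0 and [b] is the only letter
   selected. *)
rewrite (_ : filter _ _ = [::]) /=; last by elim: (ev).
by rewrite !drop0 E.
Qed.

Lemma rsk_drop k t w :
  drop k.+1 (rsk_aux t w).1 =
  (rsk_aux (drop k.+1 t) [seq e.2 | e <- (rsk_aux t w).2 & e.1 == k]).1.
Proof.
elim: w t => // a w IH t; rewrite rsk_cons IH tab_ins_drop -rsk_cat.
by rewrite /=; case: (tab_ins a t) => t1 e1; case: (rsk_aux t1 w) => t2 e2 /=;
  rewrite filter_cat map_cat.
Qed.

(** Insertion compares letters only, so it commutes with erasing tags. This links [shRSK], which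
    tags a word afresh, to words of occurrences that keep their original positions. *)
Definition untag p : occ T := (p.1, 0).

Lemma row_ins_untag a r :
  row_ins (untag a) (map untag r) =
  (map untag (row_ins a r).1, omap untag (row_ins a r).2).
Proof. by elim: r => //= c r ->; case: ifP => //; case: (row_ins a r). Qed.

Lemma tab_ins_untag a t :
  (tab_ins (untag a) (map (map untag) t)).1 = map (map untag) (tab_ins a t).1.
Proof.
elim: t a => //= r t IH a; rewrite row_ins_untag.
case: (row_ins a r) => r' [b|] //=.
by have := IH b; case: (tab_ins b t) => t2 e2; case: tab_ins => t3 e3 /= ->.
Qed.

Lemma rsk_untag t w :
  (rsk_aux (map (map untag) t) (map untag w)).1 =
  map (map untag) (rsk_aux t w).1.
Proof.
by elim: w t => // a w IH t; rewrite map_cons !rsk_cons tab_ins_untag IH.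
Qed.

Lemma map_fst_tag (x : seq T) : map fst (Defs.tag x) = x.
Proof. by rewrite /Defs.tag -/unzip1 unzip1_zip // size_iota. Qed.

Lemma map_snd_tag (x : seq T) : map snd (Defs.tag x) = iota 0 (size x).
Proof. by rewrite /Defs.tag -/unzip2 unzip2_zip // size_iota. Qed.

Lemma shRSK_map_fst w : shRSK (map fst w) = map size (rsk_aux [::] w).1.
Proof.
have szE v : map size (rsk_aux [::] (map untag v)).1 = map size (rsk_aux [::] v).1.
  by rewrite (rsk_untag [::]) -map_comp; apply: eq_map => r /=; rewrite size_map.
rewrite /shRSK /RSK_P -szE -[RHS]szE; congr (map size (rsk_aux _ _).1).
have untagE v : map untag v = map (pair^~ 0) (map fst v) by rewrite -map_comp.
by rewrite !untagE map_fst_tag.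
Qed.

(** * Walks in the reading word of a tableau *)

(** The entry directly above [p] in its column; a letter in none of the rows after the first is
    fixed, as a dummy value. *)
Fixpoint up t p : occ T :=
  if t is r :: t' then
    if t' is s :: _ then if p \in s then nth p r (index p s) else up t' p
    else p
  else p.

Lemma inv_catl w w' p q : inv w p q -> inv (w ++ w') p q.
Proof.
move=> pq; have [pw qw] := (inv_meml pq, inv_memr pq).
by move: pq; rewrite /inv !index_cat mem_cat pw qw.
Qed.

(** Column strictness makes the entry above exist and be smaller, and higher rows are read later.
    The last clause says that a step climbs only one row, so that climbing can be iterated. *)
Lemma up_spec t : tableau t -> uniq (flatten t) ->
  [/\ {in flatten (behead t) &, injective (up t)},
      {in flatten (behead t), forall p, inv (read t) p (up t p)}
    & forall k, {in flatten (drop k.+1 t), forall p, up t p \in flatten (drop k t)}].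
Proof.
elim: t => [|r t IH] tt; first by split.
rewrite /= cat_uniq => /and3P[ur /hasPn rNt ut].
case: t IH tt rNt ut => [|s t] IH tt rNt ut; first by split.
have [injf invf dropf] := IH (tableau_behead tt) ut.
have crs : colstrict r s by case/andP: tt => _ /= /andP[].
have rs p : p \in s -> nth p r (index p s) \in r /\ ((nth p r (index p s)).1 < p.1)%O.
  move=> ps; have ip : index p s < size s by rewrite index_mem.
  have [ir lt] := colstrict_nth p crs ip; split; first exact: mem_nth.
  by rewrite nth_index in lt.
have upt p : p \in flatten (s :: t) -> p \notin s -> up (s :: t) p \in flatten (s :: t).
  rewrite mem_cat orbC => pt /negPf ps; rewrite ps orbF in pt.
  by have := inv_memr (invf p pt); rewrite (perm_mem (perm_read _)).
split.
- move=> p q pt qt.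
  have [ps|ps] := boolP (p \in s); have [qs|qs] := boolP (q \in s).
  + have ip : index p s < size s by rewrite index_mem.
    have iq : index q s < size s by rewrite index_mem.
    have [ipr _] := colstrict_nth p crs ip; have [iqr _] := colstrict_nth q crs iq.
    rewrite (set_nth_default p q iqr) => /eqP; rewrite nth_uniq // => /eqP eqi.
    by rewrite -(nth_index p ps) eqi nth_index.
  + by move=> e; have := rNt _ (upt q qt qs); rewrite -e; have [-> _] := rs p ps.
  + by move=> e; have := rNt _ (upt p pt ps); rewrite e; have [-> _] := rs q qs.
  + move: pt qt; rewrite !mem_cat (negPf ps) (negPf qs) /=; exact: injf.
- move=> p pt; rewrite read_cons.
  have [ps|ps] := boolP (p \in s).
    have [qr lt] := rs p ps; rewrite inv_cat_in ?lt //.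
      by rewrite (perm_mem (perm_read _)).
    by apply/negP; rewrite (perm_mem (perm_read _)) => /rNt; rewrite qr.
  by apply/inv_catl/invf; move: pt; rewrite mem_cat (negPf ps).
- case=> [|k] p pt.
    rewrite mem_cat; have [ps|ps] := boolP (p \in s); first by have [-> _] := rs p ps.
    by rewrite upt ?orbT //; move: pt; rewrite /= drop0.
  rewrite ifF; first exact: dropf.
  apply/negP=> ps; move: pt => /=; move: ut; rewrite /= cat_uniq => /and3P[_ /hasPn sNt _].
  case/flattenP=> q /mem_drop qt pq; have /sNt : p \in flatten t by apply/flattenP; exists q.
  by rewrite ps.
Qed.

Lemma walks_read t k : tableau t -> uniq (flatten t) ->
  walks (read t) k (flatten (drop k t)).
Proof.
move=> tt ut; have [injf invf dropf] := up_spec tt ut.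
have sub k' : {subset flatten (drop k'.+1 t) <= flatten (behead t)}.
  move=> p /flattenP[r rt pr]; apply/flattenP; exists r => //.
  by move: rt; rewrite -addn1 -drop_drop drop1; apply: mem_drop.
elim: k => //= k IH; exists (up t); split.
- by move=> p q /sub pt /sub qt; apply: injf.
- by move=> p /sub; apply: invf.
- by apply: walks_sub IH => _ /mapP[p pt ->]; apply: dropf.
Qed.

(* Rows are weakly increasing, so a step of the reading word reaches a higher row. *)
Lemma inv_read t m p q : all (sorted leo) t -> uniq (flatten t) ->
  inv (read t) p q -> q \in flatten (drop m t) -> p \in flatten (drop m.+1 t).
Proof.
elim: t m => [|r t IH] m /=; first by move=> _ _ /inv_meml.
case/andP=> sr st; rewrite cat_uniq => /and3P[ur /hasPn rNt ut].
rewrite read_cons; have [pt|pt] := boolP (p \in read t).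
  case: m => [|m] /=; first by rewrite drop0 -(perm_mem (perm_read _)).
  move=> pq /[dup] qt' /flattenP[s /mem_drop st' qs]; apply: IH => //.
  have qt : q \in read t by rewrite (perm_mem (perm_read _)); apply/flattenP; exists s.
  by move: pq; rewrite /inv !index_cat pt qt mem_cat qt.
rewrite inv_cat_notin // => /andP[_ /and3P[qp ltpq qr]]; exfalso.
have pr : p \in r by rewrite -index_mem (leq_trans ltpq) // ltnW // index_mem.
have := sorted_ltn_nth leo_trans p sr (index p r) (index q r).
rewrite !inE !index_mem => /(_ pr qr ltpq); rewrite !nth_index //.
by rewrite leNgt qp.
Qed.

(** Followed backwards from its end, a walk descends at least one row per step. *)
Lemma walks_read_start t m A : all (sorted leo) t -> uniq (flatten t) ->
    {subset A <= read t} -> walks (read t) m A ->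
  {subset A <= flatten (drop m t)}.
Proof.
move=> st ut; elim: m A => [|m IH] A sA /=.
  by move=> _ p /sA; rewrite drop0 (perm_mem (perm_read _)).
case=> f [_ invf walkf] p Ap; apply: (inv_read st ut (invf p Ap)).
apply: (IH (map f A)) (map_f f Ap) => // _ /mapP[q Aq ->].
exact: inv_memr (invf q Aq).
Qed.

(** * Cells below a row as maximal walk systems *)

(** The walks up the columns are pulled back from the reading word to [w], with their starts
    unchanged. *)
Lemma walks_rsk w k : uniq w -> walks w k (flatten (drop k (rsk_aux [::] w).1)).
Proof.
move=> uw; apply: (knuth_walks uw (knuth_rsk w (t := [::]) isT)).
by apply: walks_read; [apply: tableau_rsk | rewrite (perm_uniq (perm_rsk w))].
Qed.

(** Pushed forward to the reading word, the system keeps its size and its starts lie below the first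
    [m] rows. With [walks_rsk], the bound is attained. *)
Lemma size_walks_rsk w m A : uniq w -> uniq A -> {subset A <= w} -> walks w m A ->
  size A <= size (flatten (drop m (rsk_aux [::] w).1)).
Proof.
move=> uw uA sA /(walks_knuth uw (knuth_rsk w (t := [::]) isT) uA sA).
case=> B [<- uB sB wB]; apply: uniq_leq_size => //.
apply: walks_read_start wB => //; last by rewrite (perm_uniq (perm_rsk w)).
by have /andP[] := tableau_rsk w (t := [::]) isT.
Qed.

(** * Comparison of the two shapes *)

Lemma inv_filter (P : pred (occ T)) w p q : inv (filter P w) p q -> inv w p q.
Proof.
case/and3P=> qp ltpq qv; have pv : p \in filter P w.
  by rewrite -index_mem (leq_trans ltpq) // ltnW // index_mem.
move: ltpq qv pv; rewrite /inv !mem_filter qp => ltpq /andP[Pq ->] /andP[Pp _].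
rewrite andbT /=; elim: w ltpq => //= a w IH.
case: ifP => [_|nPa] /=.
  by case: (a == p); case: (a == q); rewrite // !ltnS.
have /negPf-> : a != p by apply: contraFneq nPa => ->.
have /negPf-> : a != q by apply: contraFneq nPa => ->.
by rewrite ltnS.
Qed.

Lemma uniq_flatten_drop j (t : seq (row T)) :
  uniq (flatten t) -> uniq (flatten (drop j t)).
Proof. by rewrite -{1}(cat_take_drop j t) flatten_cat cat_uniq => /and3P[]. Qed.

Lemma mem_flatten_drop j (t : seq (row T)) :
  {subset flatten (drop j t) <= flatten t}.
Proof.
by move=> p; rewrite -{2}(cat_take_drop j t) flatten_cat mem_cat orbC => ->.
Qed.

Lemma tag_inj (x : seq T) : {in Defs.tag x &, injective snd}.
Proof.
move=> p q px qx e; rewrite -(nth_index p px) -(nth_index p qx).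
have ux : uniq (map snd (Defs.tag x)) by rewrite map_snd_tag iota_uniq.
congr nth; apply/eqP; rewrite -(nth_uniq p.2 _ _ ux) ?size_map ?index_mem //.
by rewrite !(nth_map p) ?index_mem // !nth_index // e.
Qed.

End Walks.

Theorem mainTheorem8 (d : Order.disp_t) (T : orderType d) (k : nat) (x : seq T) :
  (1 <= k)%N -> dominates (shRSK (xbar k x)) (shRSK (xk k x)).
Proof.
case: k => // k _; set w := Defs.tag x; set bs := bumped_occ k.+1 x.
have uw : uniq w by apply: (@map_uniq _ _ snd); rewrite map_snd_tag iota_uniq.
set t := (rsk_aux [::] w).1.
have dropE : drop k.+1 t = (rsk_aux [::] bs).1 by apply: rsk_drop.
have pbs : perm_eq (flatten (drop k.+1 t)) bs by rewrite dropE perm_rsk.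
have sbs : {subset bs <= w}.
  by move=> p; rewrite -(perm_mem pbs) -(perm_mem (perm_rsk w)); apply: mem_flatten_drop.
have ubs : uniq bs.
  by rewrite -(perm_uniq pbs) uniq_flatten_drop // (perm_uniq (perm_rsk w)).
(* The tagged form of [xbar]: the letters of [bs] in the order of [x]. *)
set v := [seq p <- w | p.2 \in map snd bs].
have memv : v =i bs.
  move=> p; rewrite mem_filter; apply/andP/idP => [[/mapP[q qb e] pw]|pb].
    by rewrite (tag_inj pw (sbs q qb) e).
  by rewrite map_f // sbs.
have uv : uniq v by apply: filter_uniq.
rewrite /xbar /xk -/w -/bs -/v !shRSK_map_fst -dropE.
set s := (rsk_aux [::] v).1.
have sumE (u : seq (row T)) : sumn (map size u) = size (flatten u).
  by rewrite size_flatten.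
have szE : size (flatten s) = size (flatten (drop k.+1 t)).
  rewrite (perm_size pbs) (perm_size (perm_rsk v)).
  exact/perm_size/uniq_perm.
split=> [|j]; first by rewrite !sumE.
rewrite -!map_take !sumE.
have szT (u : seq (row T)) :
    size (flatten u) = size (flatten (take j u)) + size (flatten (drop j u)).
  by rewrite -size_cat -flatten_cat cat_take_drop.
have sub : {subset flatten (drop j s) <= v}.
  by move=> p /mem_flatten_drop; rewrite (perm_mem (perm_rsk v)).
(* The totals agree by [szE], so dominance on the first [j] rows amounts to the reverse inequality
   on the remaining rows. *)
have : size (flatten (drop j s)) <= size (flatten (drop j (drop k.+1 t))).
  rewrite drop_drop; apply: size_walks_rsk => //.
  - by rewrite uniq_flatten_drop // (perm_uniq (perm_rsk v)).
  - by move=> p /sub; rewrite mem_filter => /andP[].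
  (* Take [j] steps inside [v], then [k.+1] steps inside [w]; the latter can start from all of [v],
     whose letters are the entries of [t] below its first [k.+1] rows. *)
  - apply: (walks_cat (w' := v)) => //; first exact: inv_filter.
      exact: walks_rsk.
    apply: walks_sub (walks_rsk k.+1 uw) => p; rewrite memv.
    by rewrite (perm_mem pbs).
rewrite -(leq_add2l (size (flatten (take j (drop k.+1 t))))) -szT -szE (szT s).
by rewrite leq_add2r.
Qed.
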